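(* For every real number $\alpha<1$ there exists a Borel parisian set $E\subset\mathbb{T}$ such that $E$ is an additive subgroup of $\mathbb{T}$ and $\dim_H(E)\geq\alpha$.
   Context: The circle $\mathbb{T}=\mathbb{R}/2\mathbb{Z}$ (an additive group) is identified with $(-1,1]$. For a finite complex Borel measure $\mu$ on $\mathbb{T}$, its Fourier coefficients are $\widehat{\mu}(n)=\frac12\int e^{i\pi n x}\,d\mu(x)$, $n\in\mathbb{Z}$, and $\mathrm{supp}(\widehat{\mu})=\{n\in\mathbb{Z}:\widehat{\mu}(n)\neq 0\}$. A set $\Lambda\subset\mathbb{Z}$ is called a Rajchman set if for every finite complex Borel measure $\mu$ on $\mathbb{T}$: whenever $\widehat{\mu}(n)\to 0$ as $|n|\to\infty$, $n\in\mathbb{Z}\setminus\Lambda$, then also $\widehat{\mu}(n)\to 0$ as $|n|\to\infty$, $n\in\Lambda$. For a Borel set $E\subset\mathbb{T}$, $M(E)$ denotes the set of finite complex Borel measures $\mu$ on $\mathbb{T}$ concentrated on $E$, i.e. $|\mu|(\mathbb{T}\setminus E)=0$. A Borel set $E\subset\mathbb{T}$ is called a parisian set if for every $\mu\in M(E)$ that is not absolutely continuous with respect to Lebesgue measure, $\mathrm{supp}(\widehat{\mu})$ is not a Rajchman set. $\dim_H$ denotes Hausdorff dimension. *)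

(* Defs.v *)
From HB Require Import structures.
From mathcomp Require Import all_boot all_order all_algebra.
From mathcomp Require Import generic_quotient ring_quotient.
From mathcomp Require Import all_classical all_reals all_analysis.
From mathcomp Require Import complex.

Set Implicit Arguments.
Unset Strict Implicit.
Unset Printing Implicit Defensive.

Import Order.TTheory GRing.Theory Num.Theory.
Import numFieldNormedType.Exports.
Import ComplexField.Normc.

Local Open Scope classical_set_scope.
Local Open Scope quotient_scope.
Local Open Scope ring_scope.

Section Circle.
Context (R : realType).

Definition twoZ : {pred R} := fun x : R => x / 2 \is a Num.int.

Fact twoZ_zmod_closed : zmod_closed twoZ.
Proof.
split=> [|x y]; first by rewrite unfold_in mul0r rpred0.
by rewrite !unfold_in mulrBl; exact: rpredB.
Qed.

HB.instance Definition _ := GRing.isZmodClosed.Build R twoZ twoZ_zmod_closed.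

(* R/2Z as a topological group: the algebraic quotient, with the quotient
   topology and its Borel sigma-algebra. *)
Definition circle : Type := quotient_topology (Quotient.quot twoZ).

HB.instance Definition _ := Quotient.on circle.
HB.instance Definition _ := GRing.Zmodule.copy circle (Quotient.quot twoZ).
HB.instance Definition _ := Topological.on circle.
HB.instance Definition _ := Pointed.on circle.
HB.instance Definition _ :=
  @isMeasurable.Build (sigma_display (@open circle)) circle <<s @open circle >>
    (@sigma_algebra0 _ setT (@open circle)) (@sigma_algebraC _ (@open circle))
    (@sigma_algebra_bigcup _ setT (@open circle)).

(* The quotient distance, i.e. the distance from x - y to 0 in R/2Z. *)
Definition cdist (x y : circle) : R :=
  inf [set `|t| | t in [set t : R | \pi_circle t = x - y]].

(* Lebesgue measure under the identification of R/2Z with ]-1, 1]; its total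
   mass is 2. *)
Definition circle_lebesgue (A : set circle) : \bar R :=
  lebesgue_measure (`]-1, 1] `&` \pi_circle @^-1` A).

End Circle.

Section ChargeIntegral.
Context d (T : measurableType d) (R : realType).
Implicit Types (nu : {charge set T -> \bar R}) (f : T -> R).

Definition hahn_pos nu : set T := sval (cid (Hahn_decomposition nu)).

Definition hahn_neg nu : set T := sval (cid (svalP (cid (Hahn_decomposition nu)))).

Definition hahn_posneg nu : hahn_decomposition nu (hahn_pos nu) (hahn_neg nu) :=
  svalP (cid (svalP (cid (Hahn_decomposition nu)))).

(* The value does not depend on the Hahn decomposition that is chosen, since
   the Jordan decomposition is unique. *)
Definition charge_integral nu f : R :=
  \int[jordan_pos (hahn_posneg nu)]_x f x -
  \int[jordan_neg (hahn_posneg nu)]_x f x.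

End ChargeIntegral.

Section ComplexMeasure.
Context d (T : measurableType d) (R : realType).

(* A complex measure, as its real and imaginary parts; charges are
   sigma-additive and finite, so these are exactly the finite complex
   measures. *)
Record complex_measure := ComplexMeasure {
  cm_re : {charge set T -> \bar R} ;
  cm_im : {charge set T -> \bar R} }.

Implicit Types (mu : complex_measure) (A : set T) (f : T -> R[i]).

Definition cm_val mu A : R[i] := Complex (fine (cm_re mu A)) (fine (cm_im mu A)).

(* |mu|(A), the supremum of sum_i |mu(F_i)| over the countable measurable
   partitions (F_i) of A. *)
Definition cm_variation mu A : \bar R :=
  ereal_sup [set (\sum_(0 <= i <oo) (normc (cm_val mu (F i)))%:E)%E |
    F in [set F : (set T)^nat | [/\ forall i, measurable (F i),
                                    trivIset setT F & \bigcup_i F i = A]]].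

Definition concentrated mu A : Prop := cm_variation mu (~` A) = 0%E.

Definition cm_abs_continuous mu (lambda : set T -> \bar R) : Prop :=
  cm_variation mu `<< lambda.

Definition cm_integral mu f : R[i] :=
  let u x := complex.Re (f x) in let v x := complex.Im (f x) in
  Complex (charge_integral (cm_re mu) u - charge_integral (cm_im mu) v)
          (charge_integral (cm_re mu) v + charge_integral (cm_im mu) u).

End ComplexMeasure.

Section Hausdorff.
Context (R : realType) (T : Type) (dist : T -> T -> R).
Implicit Types (A : set T) (s delta : R).

Definition diameter A : \bar R :=
  ereal_sup (0%E |` [set (dist x y)%:E | x in A & y in A]).

(* The guard for the empty set matters only for s = 0, where 0 `^ 0 = 1. *)
Definition hausdorff_gauge s A : \bar R :=
  if A == set0 then 0%E else (diameter A `^ s)%E.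

Definition hausdorff_premeasure s delta A : \bar R :=
  ereal_inf [set (\sum_(0 <= i <oo) hausdorff_gauge s (U i))%E |
    U in [set U : (set T)^nat | A `<=` \bigcup_i U i /\
                                forall i, (diameter (U i) <= delta%:E)%E]].

(* The supremum is the limit as delta tends to 0. *)
Definition hausdorff_measure s A : \bar R :=
  ereal_sup [set hausdorff_premeasure s delta A | delta in [set r : R | 0 < r]].

Definition hausdorff_dim A : \bar R :=
  ereal_inf [set s%:E | s in [set s : R | 0 <= s /\ hausdorff_measure s A = 0%E]].

End Hausdorff.

Section Parisian.
Context (R : realType).
Implicit Types (mu : complex_measure (circle R) R) (E : set (circle R)).
Implicit Types (a : int -> R[i]) (L S : set int).

(* exp(i pi n x); it does not depend on the representative of x. *)
Definition circle_char (n : int) (x : circle R) : R[i] :=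
  let t := pi * n%:~R * repr x in Complex (cos t) (sin t).

Definition fourier_coef mu (n : int) : R[i] :=
  2^-1 * cm_integral mu (circle_char n).

Definition fourier_supp mu : set int := [set n | fourier_coef mu n != 0].

(* a n tends to 0 as |n| tends to infinity with n in S; this holds vacuously
   when S is finite. *)
Definition vanishes_along S a : Prop :=
  forall e : R, 0 < e -> exists N : nat,
    forall n, S n -> (N <= `|n|)%N -> normc (a n) < e.

Definition rajchman_set L : Prop :=
  forall mu, vanishes_along (~` L) (fourier_coef mu) ->
             vanishes_along L (fourier_coef mu).

Definition parisian E : Prop :=
  measurable E /\
  forall mu, concentrated mu E ->
    ~ cm_abs_continuous mu (@circle_lebesgue R) -> ~ rajchman_set (fourier_supp mu).

End Parisian.

(* Main.v *)
Require Import Defs.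
From mathcomp Require Import all_boot all_order all_algebra.
From mathcomp Require Import generic_quotient ring_quotient.
From mathcomp Require Import all_classical all_reals all_analysis.
From mathcomp Require Import measurable_realfun.
From mathcomp Require Import complex.
From mathcomp Require Import zify ring lra.

(** One subgroup E of Hausdorff dimension at least 1 serves every alpha < 1:
    the set of all x with n_k x -> 0 in R/2Z, for the rapidly growing
    frequencies n_k = 2 * 2 ^ (k ^ 3 + k ^ 2).  Such a set is a Borel subgroup
    for any sequence of frequencies.

    It is parisian as soon as |n_k| -> oo ([dirichlet_parisian]).  If mu is
    concentrated on E, the characters of index n_k tend to 1 almost everywhere
    for mu, so by dominated convergence the Fourier coefficient of index
    m + n_k tends to the one of index m, for every m.  A nonzero mu has some
    nonzero coefficient, by the uniqueness theorem for Fourier-Stieltjes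
    coefficients, hence its coefficients do not tend to 0 at infinity.  They
    vanish identically off their support, so mu itself shows that the support
    is not a Rajchman set.

    The uniqueness theorem ([finite_measure_trig_unique]) is proved for two
    finite positive measures p and q.  Call f twisted-agreeing if f times any
    character has the same integral for p and q, and call h a multiplier if
    multiplication by h preserves this property.  Multipliers form an algebra
    that is closed under bounded pointwise limits and contains the characters.
    Iterating the polynomial x (3 - x ^ 2) / 2 turns a multiplier with values
    in [-1, 1] into its sign, so indicators of arcs are multipliers, hence so
    are indicators of Borel sets, and the constant 1 twisted-agrees.

    For the dimension ([dirichlet_hausdorff_dim]), cut the binary expansion of
    t in [0, 1) into blocks, the first j of which hold j ^ 3 digits in all, and
    insert 2 j + 1 zeros before the block of index j.  The resulting number
    [spread t] lies in E because n_k shifts its expansion to a long run of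
    zeros ([dirichlet_spread]).  The zeros have density 0, so the inverse map
    is Hoelder of every exponent s < 1 ([spread_hoelder]).  A cover of E by
    small sets therefore yields a cover of [0, 1) by intervals whose lengths
    are at most a constant times the s-th powers of the diameters, and
    subadditivity of Lebesgue measure bounds the s-dimensional measure of E
    away from 0. *)

Set Implicit Arguments.
Unset Strict Implicit.
Unset Printing Implicit Defensive.

Import Order.TTheory GRing.Theory Num.Theory.
Import numFieldNormedType.Exports.
Import ComplexField.Normc.
Local Open Scope classical_set_scope.
Local Open Scope quotient_scope.
Local Open Scope ring_scope.

(** * Characters of the circle *)

Section CircleBasics.
Context (R : realType).
Local Notation circle := (circle R).
Implicit Types (t u : R) (x y : circle) (n : int).

Definition ccos n x : R := cos (pi * n%:~R * repr x).
Definition csin n x : R := sin (pi * n%:~R * repr x).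

Lemma eq_circleP t u : (\pi_circle t = \pi_circle u) <->
  exists m : int, t = u + m%:~R * 2.
Proof.
have e : (t - u \in @twoZ R) = (\pi_circle t == \pi_circle u).
  exact: (Quotient.idealrBE (@twoZ R)).
split=> [/eqP|h]; last (apply/eqP; move: h); rewrite -e.
- rewrite unfold_in => /intrP[m hm]; exists m.
  by rewrite -hm; field.
- move=> [m ->]; rewrite unfold_in; apply/intrP; exists m.
  by field.
Qed.

Lemma cosD2piz t (m : int) : cos (t + pi *+ 2 *~ m) = cos t.
Proof.
case: m => n; first exact: periodicn (@cosD2pi R) n t.
have := periodicn (@cosD2pi R) n.+1 (t + pi *+ 2 *~ Negz n).
by rewrite NegzE mulrNz -addrA addNr addr0 => ->.
Qed.

Lemma sinD2piz t (m : int) : sin (t + pi *+ 2 *~ m) = sin t.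
Proof.
case: m => n; first exact: periodicn (@sinD2pi R) n t.
have := periodicn (@sinD2pi R) n.+1 (t + pi *+ 2 *~ Negz n).
by rewrite NegzE mulrNz -addrA addNr addr0 => ->.
Qed.

Lemma repr_pi_circle t : exists m : int, repr (\pi_circle t) = t + m%:~R * 2.
Proof. by apply/eq_circleP; rewrite reprK. Qed.

Lemma ccos_pi n t : ccos n (\pi_circle t) = cos (pi * n%:~R * t).
Proof.
rewrite /ccos; have [m ->] := repr_pi_circle t.
rewrite -[RHS](cosD2piz _ (n * m)); congr cos.
by rewrite -[pi *+ 2 *~ _]mulrzr intrM mulrDr -[pi *+ 2]mulr_natr; ring.
Qed.

Lemma csin_pi n t : csin n (\pi_circle t) = sin (pi * n%:~R * t).
Proof.
rewrite /csin; have [m ->] := repr_pi_circle t.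
rewrite -[RHS](sinD2piz _ (n * m)); congr sin.
by rewrite -[pi *+ 2 *~ _]mulrzr intrM mulrDr -[pi *+ 2]mulr_natr; ring.
Qed.

Lemma pi_circleB t u : \pi_circle (t - u) = \pi_circle t - \pi_circle u.
Proof. exact: (raddfB (\pi_(Quotient.quot (@twoZ R)))). Qed.

Lemma pi_circle0 : \pi_circle 0 = 0 :> circle.
Proof. exact: (raddf0 (\pi_(Quotient.quot (@twoZ R)))). Qed.

Lemma ccos0 n : ccos n 0 = 1.
Proof. by rewrite -pi_circle0 ccos_pi mulr0 cos0. Qed.

Lemma ccosB n x y : ccos n (x - y) = ccos n x * ccos n y + csin n x * csin n y.
Proof.
rewrite -{1}(reprK x) -{1}(reprK y) -pi_circleB ccos_pi mulrBr cosB.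
by [].
Qed.

Lemma ccosD m n x : ccos (m + n) x = ccos m x * ccos n x - csin m x * csin n x.
Proof. by rewrite /ccos /csin intrD mulrDr mulrDl cosD. Qed.

Lemma csinD m n x : csin (m + n) x = csin m x * ccos n x + ccos m x * csin n x.
Proof. by rewrite /ccos /csin intrD mulrDr mulrDl sinD. Qed.

Lemma ccosN n x : ccos (- n) x = ccos n x.
Proof. by rewrite /ccos mulrNz mulrN mulNr cosN. Qed.

Lemma csinN n x : csin (- n) x = - csin n x.
Proof. by rewrite /csin mulrNz mulrN mulNr sinN. Qed.

Lemma ccos0z x : ccos 0 x = 1.
Proof. by rewrite /ccos mulr0 mul0r cos0. Qed.

Lemma ccos_abs_le1 n x : `|ccos n x| <= 1.
Proof. by rewrite ler_norml cos_geN1 cos_le1. Qed.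

Lemma csin_abs_le1 n x : `|csin n x| <= 1.
Proof. by rewrite ler_norml sin_geN1 sin_le1. Qed.

Lemma continuous_circle (f : circle -> R) : continuous (f \o \pi_circle) ->
  continuous f.
Proof. by move/(quotient_continuous (Q0 := Quotient.quot (@twoZ R))). Qed.

Lemma continuous_ccos n : continuous (ccos n).
Proof.
apply: continuous_circle.
have -> : ccos n \o \pi_circle = fun t => cos (pi * n%:~R * t).
  by apply/funext => t /=; rewrite ccos_pi.
move=> t; apply: continuous_comp; last exact: continuous_cos.
exact: mulrl_continuous.
Qed.

Lemma continuous_csin n : continuous (csin n).
Proof.
apply: continuous_circle.
have -> : csin n \o \pi_circle = fun t => sin (pi * n%:~R * t).
  by apply/funext => t /=; rewrite csin_pi.
move=> t; apply: continuous_comp; last exact: continuous_sin.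
exact: mulrl_continuous.
Qed.

Lemma open_measurable_circle (A : set circle) : open A -> measurable A.
Proof. by move=> oA; apply: sub_sigma_algebra. Qed.

Lemma continuous_measurable_circle (f : circle -> R) : continuous f ->
  measurable_fun setT f.
Proof.
move=> /continuousP cf; apply: (measurability _ (RGenOInfty.measurableE R)).
move=> _ [_ [a ->] <-]; rewrite setTI; apply: open_measurable_circle.
by apply: cf; exact: interval_open.
Qed.

End CircleBasics.

(** * Bounded measurable functions *)

Section BoundedMeasurable.
Context d (T : measurableType d) (R : realType).
Implicit Types (f g h : T -> R) (mu : {finite_measure set T -> \bar R}).

Definition bounded_measurable f :=
  measurable_fun setT f /\ exists B, forall x, `|f x| <= B.

Lemma bounded_measurable_integrable mu f :
  bounded_measurable f -> mu.-integrable setT (EFin \o f).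
Proof.
move=> [mf [B fB]]; apply: measurable_bounded_integrable => //.
  exact: fin_num_fun_lty.
exists B; split; first exact: num_real.
by move=> M BM x _ /=; exact: le_trans (fB x) (ltW BM).
Qed.

Lemma bounded_measurable_cst (c : R) : bounded_measurable (fun=> c).
Proof. by split; [exact: measurable_cst | exists `|c|]. Qed.

Lemma bounded_measurableD f g : bounded_measurable f -> bounded_measurable g ->
  bounded_measurable (fun x => f x + g x).
Proof.
move=> [mf [B fB]] [mg [C gC]]; split; first exact: measurable_funD.
by exists (B + C) => x; rewrite (le_trans (ler_normD _ _))// lerD.
Qed.

Lemma bounded_measurableM f g : bounded_measurable f -> bounded_measurable g ->
  bounded_measurable (fun x => f x * g x).
Proof.
move=> [mf [B fB]] [mg [C gC]]; split; first exact: measurable_funM.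
by exists (B * C) => x; rewrite normrM ler_pM.
Qed.

Lemma bounded_convergence mu (f_ : nat -> T -> R) f (B : R) :
  (forall n, measurable_fun setT (f_ n)) -> measurable_fun setT f ->
  (forall n x, `|f_ n x| <= B) ->
  {ae mu, forall x, f_ n x @[n --> \oo] --> f x} ->
  \int[mu]_x f_ n x @[n --> \oo] --> \int[mu]_x f x.
Proof.
move=> mf_ mf fB cvf.
have bf n : bounded_measurable (f_ n) by split => //; exists B.
have [|||||if_ _] := @dominated_convergence _ _ _ mu _ measurableT
    (fun n x => (f_ n x)%:E) (fun x => (f x)%:E) (fun=> B%:E).
- by move=> n; exact/measurable_EFinP.
- exact/measurable_EFinP.
- by apply: filterS cvf => x fx _; apply: cvg_EFin; [exact: nearW|exact: fx].
- exact: (bounded_measurable_integrable mu (bounded_measurable_cst B)).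
- by apply: aeW => x n _; rewrite lee_fin.
have -> : (\int[mu]_x (f x)%:E)%E = (\int[mu]_x f x)%:E.
  by rewrite fineK//; exact: integrable_fin_num.
by move=> /fine_cvg.
Qed.

End BoundedMeasurable.

(** * Polynomial approximation of the sign function *)

Section Sharpen.
Context (R : realType).
Implicit Types t : R.

(** An odd polynomial map of [-1, 1] to itself whose only fixed points are -1, 0
    and 1; 0 repels and the other two attract, so its iterates converge to the
    sign function. *)
Definition sharpen (t : R) := t * (3 - t ^+ 2) / 2.

Lemma sharpenN t : sharpen (- t) = - sharpen t.
Proof. by rewrite /sharpen sqrrN mulNr mulNr. Qed.

Lemma sharpen_itv t : 0 <= t <= 1 -> t <= sharpen t <= 1.
Proof.
move=> /andP[t0 t1]; rewrite -subr_ge0 -(subr_ge0 (sharpen t)); apply/andP; split.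
  have -> : sharpen t - t = t * (1 - t) * (1 + t) / 2 by rewrite /sharpen; field.
  by rewrite divr_ge0// !mulr_ge0//; lra.
have -> : 1 - sharpen t = (1 - t) ^+ 2 * (2 + t) / 2 by rewrite /sharpen; field.
by rewrite divr_ge0// mulr_ge0 ?sqr_ge0//; lra.
Qed.

Lemma iter_sharpen_itv n t : 0 <= t <= 1 -> t <= iter n sharpen t <= 1.
Proof.
move=> /andP[t0 t1]; elim: n => [|n /andP[h1 h2]] /=; first by rewrite lexx.
have /andP[h3 ->] : iter n sharpen t <= sharpen (iter n sharpen t) <= 1.
  by apply: sharpen_itv; rewrite h2 (le_trans t0).
by rewrite (le_trans h1).
Qed.

(** The factorization 1 - sharpen s = (1 - s / 2 - s ^ 2 / 2) (1 - s), together with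
    s >= t along the orbit, makes the distance to 1 decay geometrically. *)
Lemma iter_sharpen_cvg1 t : 0 < t <= 1 -> iter n sharpen t @[n --> \oo] --> (1 : R).
Proof.
move=> /andP[t0 t1].
have it n : t <= iter n sharpen t <= 1.
  by apply: iter_sharpen_itv; rewrite t1 ltW.
have bnd n : 1 - iter n sharpen t <= (1 - t / 2) ^+ n.
  elim: n => [|n ih] /=; first by rewrite expr0; lra.
  have /andP[h1 h2] := it n; set s := iter n sharpen t in h1 h2 ih *.
  rewrite exprS; apply: (@le_trans _ _ ((1 - t / 2) * (1 - s))).
    have -> : 1 - sharpen s = (1 - s / 2 - s ^+ 2 / 2) * (1 - s).
      by rewrite /sharpen; field.
    by apply: ler_wpM2r; nra.
  by apply: ler_wpM2l => //; lra.
have c0 : (1 - t / 2) ^+ n @[n --> \oo] --> (0 : R).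
  by apply: cvg_expr; rewrite ger0_norm; lra.
apply: (@squeeze_cvgr _ _ _ _ (fun n => 1 - (1 - t / 2) ^+ n) (fun=> 1)).
- by apply: nearW => n; have := bnd n; have /andP[_ ->] := it n; lra.
- by rewrite -[X in _ --> X]subr0; apply: cvgB => //; exact: cvg_cst.
- exact: cvg_cst.
Qed.

Lemma iter_sharpenN n t : iter n sharpen (- t) = - iter n sharpen t.
Proof. by elim: n => //= n ->; rewrite sharpenN. Qed.

Lemma iter_sharpen_cvg t : `|t| <= 1 ->
  iter n sharpen t @[n --> \oo] --> Num.sg t.
Proof.
rewrite ler_norml => /andP[t1 t2]; have [t0|t0|->] := ltgtP t 0.
- rewrite ltr0_sg//; have -> : (fun n => iter n sharpen t) =
      (fun n => - iter n sharpen (- t)).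
    by apply/funext => n; rewrite iter_sharpenN opprK.
  by apply: cvgN; apply: iter_sharpen_cvg1; lra.
- by rewrite gtr0_sg//; apply: iter_sharpen_cvg1; lra.
- rewrite sgr0; have -> : (fun n => iter n sharpen 0) = (fun=> 0).
    by apply/funext; elim=> //= n ->; rewrite /sharpen mul0r mul0r.
  exact: cvg_cst.
Qed.

Lemma iter_sharpen_abs n t : `|t| <= 1 -> `|iter n sharpen t| <= 1.
Proof.
move=> h; wlog t0 : t h / 0 <= t.
  move=> H; have [|t0] := leP 0 t; first exact: H.
  rewrite -normrN -iter_sharpenN; apply: H; first by rewrite normrN.
  by rewrite oppr_ge0 ltW.
rewrite ger0_norm// in h.
have /andP[h1 h2] : t <= iter n sharpen t <= 1.
  by apply: iter_sharpen_itv; rewrite t0.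
by rewrite ger0_norm// (le_trans t0).
Qed.

End Sharpen.
Arguments sharpen {R} t.

(** * Multipliers of a pair of measures *)

Section Multipliers.
Context d (T : measurableType d) (R : realType).
Variables (p q : {finite_measure set T -> \bar R}) (Phi : set (T -> R)).
Hypothesis Phi_bm : forall f, Phi f -> bounded_measurable f.
Implicit Types f g h : T -> R.

Definition agree f := \int[p]_x f x = \int[q]_x f x.

(** Agreement of the complex measures f dp and f dq against all test functions:
    what is needed for agreement to survive multiplication by a test function. *)
Definition twisted_agree f :=
  bounded_measurable f /\ forall g, Phi g -> agree (fun x => f x * g x).

(** Quantifying over all twisted-agreeing f makes closure under products and under
    limits immediate, without describing the functions that the test functions
    generate. *)
Definition multiplier h := bounded_measurable h /\
  forall f, twisted_agree f -> twisted_agree (fun x => f x * h x).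

Lemma agreeD f g : bounded_measurable f -> bounded_measurable g ->
  agree f -> agree g -> agree (fun x => f x + g x).
Proof.
move=> bf bg af ag; rewrite /agree !RintegralD//;
  try exact: bounded_measurable_integrable.
by rewrite af ag.
Qed.

Lemma agreeZ c f : bounded_measurable f -> agree f -> agree (fun x => c * f x).
Proof.
move=> bf af; rewrite /agree !RintegralZl//;
  try exact: bounded_measurable_integrable.
by rewrite af.
Qed.

Lemma agree_lim (f_ : nat -> T -> R) f (B : R) :
  (forall n, measurable_fun setT (f_ n)) -> (forall n x, `|f_ n x| <= B) ->
  (forall x, f_ n x @[n --> \oo] --> f x) ->
  (forall n, agree (f_ n)) -> agree f.
Proof.
move=> mf_ fB cvf af.
have mf : measurable_fun setT f.
  by apply: (@measurable_fun_cvg _ _ _ _ f_) => // x _; exact: cvf.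
have cp := bounded_convergence mf_ mf fB (aeW p cvf).
have cq := bounded_convergence mf_ mf fB (aeW q cvf).
rewrite /agree -(cvg_lim (@Rhausdorff R) cp) -(cvg_lim (@Rhausdorff R) cq).
by congr (lim (_ @ \oo)); apply/funext => n; exact: af.
Qed.

Lemma multiplier_cst c : multiplier (fun=> c).
Proof.
split; first exact: bounded_measurable_cst.
move=> f [bf af]; split.
  exact: (bounded_measurableM bf (bounded_measurable_cst _ c)).
move=> g Pg; have := agreeZ c (bounded_measurableM bf (Phi_bm Pg)) (af _ Pg).
by congr agree; apply/funext => x; rewrite mulrAC mulrC.
Qed.

Lemma multiplierD g h : multiplier g -> multiplier h ->
  multiplier (fun x => g x + h x).
Proof.
move=> [bg mg] [bh mh]; split; first exact: bounded_measurableD.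
move=> f wf; have [bf _] := wf.
have [bfg afg] := mg _ wf; have [bfh afh] := mh _ wf.
split; first by apply: bounded_measurableM => //; exact: bounded_measurableD.
move=> k Pk; have bk := Phi_bm Pk.
have := agreeD (bounded_measurableM bfg bk) (bounded_measurableM bfh bk)
  (afg _ Pk) (afh _ Pk).
by congr agree; apply/funext => x; rewrite mulrDr mulrDl.
Qed.

Lemma multiplierM g h : multiplier g -> multiplier h ->
  multiplier (fun x => g x * h x).
Proof.
move=> [bg mg] [bh mh]; split; first exact: bounded_measurableM.
move=> f wf; have := mh _ (mg _ wf); congr twisted_agree.
by apply/funext => x; rewrite mulrA.
Qed.

(** Dominated convergence, on both sides of each equality of integrals. *)
Lemma multiplier_lim (h_ : nat -> T -> R) h (B : R) :
  (forall n, multiplier (h_ n)) -> (forall n x, `|h_ n x| <= B) ->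
  (forall x, h_ n x @[n --> \oo] --> h x) -> multiplier h.
Proof.
move=> mh hB cvh.
have bh : bounded_measurable h.
  split.
    apply: (@measurable_fun_cvg _ _ _ _ h_) => [n|x _]; last exact: cvh.
    by have [[]] := mh n.
  exists B => x; rewrite -(cvg_lim (@Rhausdorff R) (cvg_norm (cvh x))).
  apply: limr_le; last by apply: nearW => n; exact: hB.
  by apply: cvgP; apply: cvg_norm; exact: cvh.
split => // f wf; have [[mf [C fC]] _] := wf.
split; first by apply: bounded_measurableM => //; split => //; exists C.
move=> g Pg; have [mg [D gD]] := Phi_bm Pg.
apply: (@agree_lim (fun n x => f x * h_ n x * g x) _ (C * B * D)).
- move=> n; have [[mhn _] _] := mh n.
  by apply: measurable_funM => //; exact: measurable_funM.
- by move=> n x; rewrite !normrM ler_pM// ?mulr_ge0// ler_pM.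
- move=> x; apply: cvgM; last exact: cvg_cst.
  by apply: cvgM; [exact: cvg_cst|exact: cvh].
- by move=> n; have [_ /(_ _ wf)[_]] := mh n; exact.
Qed.

(** The sign of h is the bounded limit of polynomials in h. *)
Lemma multiplier_sg h : multiplier h -> (forall x, `|h x| <= 1) ->
  multiplier (fun x => Num.sg (h x)).
Proof.
move=> mh h1; apply: (@multiplier_lim (fun n x => iter n sharpen (h x)) _ 1).
- elim=> [//|n ih] /=; rewrite /sharpen.
  apply: multiplierM; last exact: multiplier_cst.
  apply: multiplierM => //; apply: multiplierD; first exact: multiplier_cst.
  rewrite [X in multiplier X](_ : _ =
    fun x => -1 * (iter n sharpen (h x) * iter n sharpen (h x))).
    by apply: multiplierM; [exact: multiplier_cst|exact: multiplierM].
  by apply/funext => x; rewrite mulN1r expr2.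
- by move=> n x; exact: iter_sharpen_abs.
- by move=> x; exact: iter_sharpen_cvg.
Qed.

(** The indicator of h > 0 is the polynomial (S ^ 2 + S) / 2 of the sign S of h. *)
Lemma multiplier_indic_pos h : multiplier h -> (forall x, `|h x| <= 1) ->
  multiplier (\1_[set x | 0 < h x] : T -> R).
Proof.
move=> mh h1; have ms := multiplier_sg mh h1.
rewrite [X in multiplier X](_ : _ = fun x =>
  2^-1 * (Num.sg (h x) * Num.sg (h x) + Num.sg (h x))).
  apply: multiplierM; first exact: multiplier_cst.
  by apply: multiplierD => //; exact: multiplierM.
apply/funext => x; rewrite indicE.
have [x0|x0|x0] := ltgtP (h x) 0.
- rewrite ltr0_sg// memNset /=; last by rewrite ltNge ltW.
  by rewrite mulrNN mulr1 subrr mulr0.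
- rewrite gtr0_sg// mem_set//= mulr1 -(mulr_natr 1 2) mul1r mulVf//.
- rewrite x0 sgr0 memNset /=; last by rewrite x0 ltxx.
  by rewrite mulr0 addr0 mulr0.
Qed.

(** Complements are handled by 1 - h; the complement of a countable union is the
    limit of the finite products of the indicators of the complements. *)
Lemma sigma_algebra_multiplier :
  sigma_algebra setT [set A | multiplier (\1_A : T -> R)].
Proof.
have mC A : multiplier (\1_A : T -> R) -> multiplier (\1_(~` A) : T -> R).
  move=> mA; rewrite [X in multiplier X](_ : _ = fun x => 1 + -1 * \1_A x).
    apply: multiplierD; first exact: multiplier_cst.
    by apply: multiplierM => //; exact: multiplier_cst.
  apply/funext => x; rewrite !indicE in_setC.
  by case: (x \in A) => /=; lra.
split=> /=.
- by rewrite indic0; exact: multiplier_cst.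
- by move=> A; rewrite setTD; exact: mC.
- move=> A mA; rewrite -[\bigcup_k _]setCK; apply/mC.
  pose P n x : R := \prod_(i < n) \1_(~` A i) x.
  have P01 n x : 0 <= P n x <= 1.
    rewrite prodr_ge0 => [|i _]; last by rewrite indicE ler0n.
    by apply: prodr_ile1 => i; rewrite indicE ler0n lern1 leq_b1.
  apply: (@multiplier_lim P _ 1).
  + elim=> [|n ih].
      rewrite [X in multiplier X](_ : _ = fun=> 1); first exact: multiplier_cst.
      by apply/funext => x; rewrite /P big_ord0.
    rewrite [X in multiplier X](_ : _ = fun x => P n x * \1_(~` A n) x).
      by apply: multiplierM => //; apply/mC; exact: mA.
    by apply/funext => x; rewrite /P big_ord_recr.
  + by move=> n x; have /andP[? ?] := P01 n x; rewrite ger0_norm.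
  + move=> x; rewrite indicE; have [[k _ Akx]|nA] := pselect ((\bigcup_k A k) x).
      rewrite memNset /=; last by move=> h; apply: h; exists k.
      apply: cvg_near_cst; near=> n.
      have kn : (k < n)%N by near: n; exists k.+1.
      rewrite /P (bigD1 (Ordinal kn))//= indicE memNset ?mul0r//=.
    rewrite mem_set//; apply: cvg_near_cst; apply: nearW => n.
    rewrite /P big1// => i _; rewrite indicE mem_set// => Aix.
    by apply: nA; exists i.
Unshelve. all: by end_near.
Qed.

End Multipliers.

(** * Uniqueness of Fourier-Stieltjes coefficients *)

Section FourierUniqueness.
Context (R : realType).
Local Notation circle := (circle R).

Definition trig : set (circle -> R) :=
  [set f | exists n, f = @ccos R n \/ f = @csin R n].

Lemma bounded_measurable_ccos n : bounded_measurable (@ccos R n).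
Proof.
split.
  by have := continuous_measurable_circle (@continuous_ccos R n).
by exists 1 => x; exact: ccos_abs_le1.
Qed.

Lemma bounded_measurable_csin n : bounded_measurable (@csin R n).
Proof.
split.
  by have := continuous_measurable_circle (@continuous_csin R n).
by exists 1 => x; exact: csin_abs_le1.
Qed.

Lemma bounded_measurable_trig f : trig f -> bounded_measurable f.
Proof.
by move=> [n [->|->]]; [exact: bounded_measurable_ccos|
  exact: bounded_measurable_csin].
Qed.

(** The points y with cos (pi (y - a)) > c, expanded by the addition formula so that
    the defining function is visibly a combination of characters. *)
Definition arc (a c : R) : set circle :=
  [set x | c < cos (pi * a) * ccos 1 x + sin (pi * a) * csin 1 x].

Lemma arc_pi a c t : arc a c (\pi_circle t) = (c < cos (pi * (t - a))) :> Prop.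
Proof.
by rewrite /arc /= ccos_pi csin_pi mulr1 mulrBr cosB mulrC [sin _ * _]mulrC.
Qed.

Lemma circle_repr_near (a : R) (x : circle) :
  exists2 t, \pi_circle t = x & `|t - a| <= 1.
Proof.
pose u : R := repr x; pose m := Num.floor ((u - a + 1) / 2).
exists (u - m%:~R * 2).
  rewrite -[RHS]reprK; apply/eq_circleP; exists (- m).
  by rewrite mulrNz mulNr.
have h1 : m%:~R <= (u - a + 1) / 2 by exact: Num.Theory.floor_le.
have h2 : (u - a + 1) / 2 < (m + 1)%:~R by exact: Num.Theory.floorD1_gt.
rewrite intrD in h2.
by rewrite ler_norml; apply/andP; split; lra.
Qed.

Lemma lt_cos_pi (s t : R) : `|s| <= 1 -> `|t| <= 1 ->
  (cos (pi * s) < cos (pi * t)) = (`|t| < `|s|).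
Proof.
move=> s1 t1; have p0 := @pi_gt0 R.
have e (r : R) : cos (pi * r) = cos (pi * `|r|).
  have [r0|r0] := lerP 0 r; first by rewrite ger0_norm.
  by rewrite ltr0_norm// mulrN cosN.
have i (r : R) : `|r| <= 1 -> pi * `|r| \in `[0, pi].
  by move=> r1; rewrite in_itv /= mulr_ge0 ?(ltW p0)//= ger_pMr.
by rewrite e (e t) ltr_cos ?i// ltr_pM2l.
Qed.

(** Arcs of rational centre a and radius 1 / (k + 1) form a countable base of the
    topology.  An arc of this radius is the set where cos (pi (y - a)) exceeds
    cos (pi / (k + 1)), because the cosine decreases on [0, pi]. *)
Lemma open_bigcup_arc (U : set circle) : open U -> exists F : nat -> R * R,
  U = \bigcup_(k in [set k | arc (F k).1 (F k).2 `<=` U]) arc (F k).1 (F k).2.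
Proof.
move=> oU.
pose G (v : rat * nat) : R * R := (ratr v.1, cos (pi / v.2.+1%:R)).
(* The default arc is harmless: only arcs contained in U enter the union. *)
exists (fun k => if unpickle k is Some v then G v else (0, 0)).
apply/seteqP; split=> [x Ux|x [k sk akx]]; last exact: sk.
pose t0 : R := repr x.
have : open ((\pi_circle : R -> circle) @^-1` U) by exact: oU.
rewrite openE => /(_ t0); rewrite /= reprK => /(_ Ux).
move=> /nbhs_ballP[e /= e0 eU].
have [k hk] : exists k : nat, 2 / k.+1%:R < e.
  exists (Num.truncn (2 / e)); rewrite ltr_pdivrMr// mulrC -ltr_pdivrMr//.
  exact: Num.Theory.truncnS_gt.
pose d : R := k.+1%:R^-1; rewrite -/d in hk.
have d0 : 0 < d by rewrite invr_gt0.
have d1 : d <= 1 by rewrite invf_le1// ler1n.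
have [a] : exists a : rat, ratr a \in `](t0 - d), (t0 + d)[.
  by apply: rat_in_itvoo; rewrite -subr_gt0; lra.
rewrite in_itv /= => /andP[a1 a2].
have [i hi] : exists i, unpickle i = Some (a, k).
  by exists (pickle (a, k)); rewrite pickleK.
exists i; rewrite /= hi /G /= -/d.
  move=> y; have [t <- ta] := circle_repr_near (ratr a) y.
  rewrite arc_pi lt_cos_pi//; last by rewrite gtr0_norm.
  rewrite (gtr0_norm d0) => h; apply: (eU t).
  rewrite /ball /=; move: h; rewrite !ltr_norml => /andP[h1 h2].
  by apply/andP; split; lra.
have xa : `|t0 - ratr a| < d by rewrite ltr_norml; apply/andP; split; lra.
have <- : \pi_circle t0 = x by rewrite reprK.
rewrite arc_pi lt_cos_pi ?(gtr0_norm d0)//.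
exact: le_trans (ltW xa) d1.
Qed.

Section TwoMeasures.
Variables p q : {finite_measure set circle -> \bar R}.

Local Notation multiplier := (multiplier p q trig).

(** The trigonometric product formulas express a product of two characters as a
    combination of two characters, and twisted agreement is linear. *)
Lemma multiplier_product_to_sum (h : circle -> R) : bounded_measurable h ->
  (forall g, trig g -> exists g1 g2 c, [/\ trig g1, trig g2 &
     forall x, h x * g x = 2^-1 * (g1 x + c * g2 x)]) ->
  multiplier h.
Proof.
move=> bh hg; split => // f [bf af].
have bfg g : trig g -> bounded_measurable (fun x => f x * g x).
  by move=> /bounded_measurable_trig; exact: bounded_measurableM.
split; first exact: bounded_measurableM.
move=> g /hg[g1 [g2 [c [Pg1 Pg2 gE]]]].
have : agree p q (fun x => 2^-1 * (f x * g1 x + c * (f x * g2 x))).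
  have b2 : bounded_measurable (fun x => c * (f x * g2 x)).
    by apply: bounded_measurableM (bfg _ Pg2); exact: bounded_measurable_cst.
  apply: agreeZ; first by apply: bounded_measurableD => //; exact: bfg.
  apply: agreeD => //; [exact: bfg|exact: af|].
  by apply: agreeZ; [exact: bfg|exact: af].
by congr agree; apply/funext => x; rewrite -mulrA gE; ring.
Qed.

Lemma multiplier_ccos1 : multiplier (@ccos R 1).
Proof.
apply: multiplier_product_to_sum; first exact: bounded_measurable_ccos.
move=> _ [n [->|->]].
  exists (@ccos R (n + 1)), (@ccos R (n - 1)), 1; split.
  - by exists (n + 1); left.
  - by exists (n - 1); left.
  - by move=> x; rewrite !ccosD ccosN csinN; field.
exists (@csin R (n + 1)), (@csin R (n - 1)), 1; split.
- by exists (n + 1); right.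
- by exists (n - 1); right.
- by move=> x; rewrite !csinD ccosN csinN; field.
Qed.

Lemma multiplier_csin1 : multiplier (@csin R 1).
Proof.
apply: multiplier_product_to_sum; first exact: bounded_measurable_csin.
move=> _ [n [->|->]].
  exists (@csin R (n + 1)), (@csin R (n - 1)), (-1); split.
  - by exists (n + 1); right.
  - by exists (n - 1); right.
  - by move=> x; rewrite !csinD ccosN csinN; field.
exists (@ccos R (n - 1)), (@ccos R (n + 1)), (-1); split.
- by exists (n - 1); left.
- by exists (n + 1); left.
- by move=> x; rewrite !ccosD ccosN csinN; field.
Qed.

Lemma multiplier_arc a c : multiplier (\1_(arc a c) : circle -> R).
Proof.
(* Normalization: the trigonometric part is at most 2 in absolute value. *)
pose K : R := 2 + `|c|.
have K0 : 0 < K by rewrite /K ltr_pwDl.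
pose h (x : circle) := K^-1 * ((cos (pi * a) * ccos 1 x + sin (pi * a) * csin 1 x) - c).
have -> : arc a c = [set x | 0 < h x].
  by apply/seteqP; split => x; rewrite /arc /h /= pmulr_rgt0 ?invr_gt0// subr_gt0.
apply: multiplier_indic_pos; first exact: bounded_measurable_trig.
  have mc := multiplier_cst p q bounded_measurable_trig.
  have mD := @multiplierD _ _ _ p q _ bounded_measurable_trig.
  have mM := @multiplierM _ _ _ p q trig.
  apply: (mM (fun=> _)); first exact: mc.
  apply: (mD _ (fun=> - c)); last exact: mc.
  apply: mD.
    by apply: (mM (fun=> _)); [exact: mc|exact: multiplier_ccos1].
  by apply: (mM (fun=> _)); [exact: mc|exact: multiplier_csin1].
move=> x; rewrite /h normrM gtr0_norm ?invr_gt0// mulrC ler_pdivrMr// mul1r.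
rewrite /K (le_trans (ler_normB _ _))// lerD2r (le_trans (ler_normD _ _))//.
by rewrite -[leRHS]/(1 + 1) lerD// normrM -[leRHS]mul1r ler_pM//
  ?ccos_abs_le1 ?csin_abs_le1// ler_norml ?cos_geN1 ?cos_le1 ?sin_geN1 ?sin_le1.
Qed.

Lemma multiplier_indic (A : set circle) : measurable A ->
  multiplier (\1_A : circle -> R).
Proof.
have S := sigma_algebra_multiplier p q bounded_measurable_trig.
have [S0 _ SU] := S.
move: A; apply: smallest_sub => // U /open_bigcup_arc[F ->].
rewrite bigcup_mkcond; apply: SU => k; case: ifPn => // _.
exact: multiplier_arc.
Qed.

(** The hypotheses say that the constant 1 twisted-agrees; multiply it by the
    indicator of A and test against the character of index 0. *)
Theorem finite_measure_trig_unique :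
  (forall n, \int[p]_x ccos n x = \int[q]_x ccos n x) ->
  (forall n, \int[p]_x csin n x = \int[q]_x csin n x) ->
  forall A, measurable A -> p A = q A.
Proof.
move=> hc hs A mA.
have w1 : twisted_agree p q trig (fun=> 1).
  split; first exact: bounded_measurable_cst.
  move=> g; rewrite (_ : (fun x => _) = g); last by apply/funext => x; rewrite mul1r.
  by move=> [n [->|->]]; [exact: hc|exact: hs].
have [_ /(_ _ w1)[_ /(_ (@ccos R 0))]] := multiplier_indic mA.
have -> : (fun x : circle => 1 * \1_A x * ccos 0 x) = \1_A.
  by apply/funext => x; rewrite ccos0z mul1r mulr1.
move=> /(_ _); rewrite /agree /Rintegral !integral_indic// !setIT => h.
have pA := fin_num_measure p A mA; have qA := fin_num_measure q A mA.
by rewrite -(fineK pA) -(fineK qA) h//; exists 0; left.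
Qed.

End TwoMeasures.
End FourierUniqueness.

(** * Complex measures and their Jordan parts *)

Section Modulus.
Context (R : realType).

Lemma modulus_ge0 (z : R[i]) : 0 <= normc z.
Proof. by case: z => a b; exact: sqrtr_ge0. Qed.

Lemma modulus_ge_Re (a b : R) : `|a| <= normc (Complex a b).
Proof. by rewrite -sqrtr_sqr ler_wsqrtr// lerDl sqr_ge0. Qed.

Lemma modulus_ge_Im (a b : R) : `|b| <= normc (Complex a b).
Proof. by rewrite -sqrtr_sqr ler_wsqrtr// lerDr sqr_ge0. Qed.

End Modulus.

Section ComplexMeasureNull.
Context d (T : measurableType d) (R : realType).
Implicit Types (nu : {charge set T -> \bar R}) (mu : complex_measure T R).

(** A and its complement in D form a partition of D, so |mu(A)| is at most the
    variation of mu on D. *)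
Lemma cm_variation_eq0 mu (D A : set T) : cm_variation mu D = 0%E ->
  measurable D -> measurable A -> A `<=` D ->
  cm_re mu A = 0%E /\ cm_im mu A = 0%E.
Proof.
move=> v0 mD mA AD.
have h : (normc (cm_val mu A) <= 0)%R.
  rewrite -lee_fin -[leRHS]v0.
  pose F (i : nat) : set T := if i == 0%N then A else if i == 1%N then D `\` A else set0.
  apply: le_trans (ereal_sup_ubound _); last first.
    exists F => //; split.
    - move=> [|[|i]] /=; rewrite /F//=; exact: measurableD.
    - apply/trivIsetP => -[|[|i]] [|[|j]] //= _ _ _;
        rewrite /F /= ?set0I ?setI0// ?setDIK//.
      by rewrite setIC setDIK.
    - apply/seteqP; split => [x [[|[|i]] _]|x Dx]; rewrite /F //=; first exact: AD.
        by case.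
      by have [Ax|nAx] := pselect (A x); [exists 0%N|exists 1%N].
  apply: le_trans (nneseries_lim_ge 1 _); last first.
    by move=> n _ _; rewrite lee_fin modulus_ge0.
  by rewrite big_nat1.
have : cm_val mu A = 0 by apply: eq0_normc; apply: le_anti; rewrite h modulus_ge0.
rewrite /cm_val => -[h1 h2].
have f1 := fin_num_measure (cm_re mu) A mA.
have f2 := fin_num_measure (cm_im mu) A mA.
by split; [rewrite -(fineK f1) h1|rewrite -(fineK f2) h2].
Qed.

Lemma null_charges_cm_variation mu (A : set T) : measurable A ->
  (forall B, measurable B -> cm_re mu B = 0%E /\ cm_im mu B = 0%E) ->
  cm_variation mu A = 0%E.
Proof.
move=> mA m0.
have s0 (F : (set T)^nat) : (forall i, measurable (F i)) ->
    (\sum_(0 <= i <oo) (normc (cm_val mu (F i)))%:E)%E = 0%E.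
  move=> mF; apply: eseries0 => i _ _.
  by have [h1 h2] := m0 _ (mF i); rewrite /cm_val h1 h2 /= !expr0n addr0 sqrtr0.
apply/eqP; rewrite eq_le; apply/andP; split.
  by apply: ge_ereal_sup => _ [F [mF _ _] <-]; rewrite s0.
apply: ereal_sup_ubound.
exists (fun i => if i == 0%N then A else set0).
  split.
  - by case=> [|i] /=.
  - by apply/trivIsetP => -[|i] [|j] //= _ _ _; rewrite ?set0I ?setI0.
  - apply/seteqP; split => [x [[|i] _]//|x Ax]; by exists 0%N.
by apply: s0 => -[|i] /=.
Qed.

(** The Jordan parts of nu at D are, up to sign, the values of nu at two subsets of D. *)
Lemma jordan_null nu (D : set T) : measurable D ->
  (forall A, measurable A -> A `<=` D -> nu A = 0%E) ->
  jordan_pos (hahn_posneg nu) D = 0%E /\ jordan_neg (hahn_posneg nu) D = 0%E.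
Proof.
move=> mD nu0; have [[mP _] [mN _] _ _] := hahn_posneg nu.
split.
  rewrite jordan_posE cjordan_posE /crestr0 mem_set// /crestr.
  by apply: nu0; [exact: measurableI|exact: subIsetl].
rewrite jordan_negE cjordan_negE /crestr0 mem_set// /crestr.
have -> : nu (D `&` hahn_neg nu) = 0%E.
  by apply: nu0; [exact: measurableI|exact: subIsetl].
by rewrite oppe0.
Qed.

Lemma charge_integral_cvg nu (E : set T) (f_ : nat -> T -> R) (f : T -> R) (B : R) :
  measurable E -> (forall A, measurable A -> A `<=` ~` E -> nu A = 0%E) ->
  (forall n, measurable_fun setT (f_ n)) -> measurable_fun setT f ->
  (forall n x, `|f_ n x| <= B) ->
  (forall x, E x -> f_ n x @[n --> \oo] --> f x) ->
  charge_integral nu (f_ n) @[n --> \oo] --> charge_integral nu f.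
Proof.
move=> mE nu0 mf_ mf fB cvf.
have [p0 n0] := jordan_null (measurableC mE) nu0.
have ae (m : {finite_measure set T -> \bar R}) : m (~` E) = 0%E ->
    {ae m, forall x, f_ n x @[n --> \oo] --> f x}.
  move=> m0; exists (~` E); split => //; first exact: measurableC.
  by move=> x /= nf Ex; apply: nf; exact: cvf.
by apply: cvgB; apply: bounded_convergence (fB) _ => //; exact: ae.
Qed.

Lemma charge_integralN nu (f : T -> R) : bounded_measurable f ->
  charge_integral nu (fun x => - f x) = - charge_integral nu f.
Proof.
move=> bf; rewrite /charge_integral.
have RN (m : {finite_measure set T -> \bar R}) :
    \int[m]_x (- f x) = - \int[m]_x f x.
  rewrite -mulN1r -RintegralZl//; last exact: bounded_measurable_integrable.
  by congr (Rintegral _ _ _); apply/funext => x; rewrite mulN1r.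
by rewrite !RN opprB opprK addrC.
Qed.

End ComplexMeasureNull.

(** * Subgroups along which characters tend to 1 *)

Section DirichletSubgroup.
Context (R : realType).
Local Notation circle := (circle R).
Implicit Types (mu : complex_measure circle R).

(** Convergence of the real part alone says that n_k x -> 0 in the circle: the
    characters have modulus 1, see [dirichlet_csin]. *)
Definition dirichlet_subgroup (n_ : nat -> int) : set circle :=
  [set x | ccos (n_ k) x @[k --> \oo] --> (1 : R)].

Variable n_ : nat -> int.
Local Notation E := (dirichlet_subgroup n_).

Lemma dirichlet_csin x : E x -> csin (n_ k) x @[k --> \oo] --> (0 : R).
Proof.
move=> Ex; apply/norm_cvg0P; rewrite -(@sqrtr0 R).
have -> : (fun k => `|csin (n_ k) x|) =
    (fun k => Num.sqrt (1 - ccos (n_ k) x * ccos (n_ k) x)).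
  apply/funext => k; rewrite -sqrtr_sqr; congr Num.sqrt.
  by rewrite /csin sin2cos2 expr2.
apply: (@continuous_cvg _ _ _ _ _ _ (@Num.sqrt R)); first exact: sqrt_continuous.
rewrite -[X in _ --> X](subrr (1 : R)) -{3}(mulr1 1).
by apply: cvgB; [exact: cvg_cst|exact: cvgM].
Qed.

Lemma dirichlet_zmod_closed : zmod_closed (mem E).
Proof.
split.
  have e : (fun k => ccos (n_ k) (0 : circle)) = (fun=> 1 : R).
    by apply/funext => k; rewrite ccos0.
  by rewrite inE /dirichlet_subgroup /= e; exact: cvg_cst.
move=> x y; rewrite !inE => Ex Ey; rewrite /= /dirichlet_subgroup /=.
have -> : (fun k => ccos (n_ k) (x - y)) =
  (fun k => ccos (n_ k) x * ccos (n_ k) y + csin (n_ k) x * csin (n_ k) y).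
  by apply/funext => k; rewrite ccosB.
have -> : (1 : R) = 1 * 1 + 0 * 0 by rewrite mulr1 mulr0 addr0.
by apply: cvgD; apply: cvgM => //; exact: dirichlet_csin.
Qed.

(** Written out with countably many quantifiers, convergence involves only the
    open sets on which a character has large real part. *)
Lemma measurable_dirichlet : measurable E.
Proof.
have -> : E = \bigcap_m \bigcup_N \bigcap_(k in [set k | (N <= k)%N])
    (ccos (n_ k) @^-1` `](1 - m.+1%:R^-1), +oo[).
  apply/seteqP; split => x.
    move=> Ex m _; have m0 : 0 < m.+1%:R^-1 :> R by rewrite invr_gt0.
    move/cvgrPdist_lt : Ex => /(_ _ m0)[N _ hN]; exists N => // k Nk /=.
    rewrite in_itv /= andbT ltrBlDr -ltrBlDl.
    by apply: le_lt_trans (hN k Nk); exact: ler_norm.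
  move=> h; apply/cvgrPdist_lt => e e0.
  have [N _ hN] := h (Num.truncn e^-1) I; exists N => // k Nk.
  have := hN k Nk; rewrite /= in_itv /= andbT ltrBlDr -ltrBlDl => h1.
  rewrite ger0_norm ?subr_ge0 ?cos_le1// (lt_trans h1)// invf_plt ?posrE//.
  exact: Num.Theory.truncnS_gt.
apply: bigcapT_measurable => m; apply: bigcupT_measurable => N.
apply: bigcap_measurable; first by exists N => /=.
move=> k _; rewrite -[X in measurable X]setTI.
exact: (continuous_measurable_circle (@continuous_ccos R (n_ k))).
Qed.

(** Multiplying by the character of index n_k has no effect in the limit on E. *)
Lemma ccos_dirichlet m x : E x -> ccos (m + n_ k) x @[k --> \oo] --> ccos m x.
Proof.
move=> Ex; rewrite (_ : (fun k => _) = (fun k =>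
  ccos m x * ccos (n_ k) x - csin m x * csin (n_ k) x)); last first.
  by apply/funext => k; rewrite ccosD.
rewrite [X in _ --> X](_ : ccos m x = ccos m x * 1 - csin m x * 0);
  last by rewrite mulr0 subr0 mulr1.
by apply: cvgB; apply: cvgM; first [exact: cvg_cst|exact: Ex|exact: dirichlet_csin].
Qed.

Lemma csin_dirichlet m x : E x -> csin (m + n_ k) x @[k --> \oo] --> csin m x.
Proof.
move=> Ex; rewrite (_ : (fun k => _) = (fun k =>
  csin m x * ccos (n_ k) x + ccos m x * csin (n_ k) x)); last first.
  by apply/funext => k; rewrite csinD.
rewrite [X in _ --> X](_ : csin m x = csin m x * 1 + ccos m x * 0);
  last by rewrite mulr0 addr0 mulr1.
by apply: cvgD; apply: cvgM; first [exact: cvg_cst|exact: Ex|exact: dirichlet_csin].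
Qed.

(** Twice the real part of the Fourier coefficient. *)
Definition fourier_re mu n : R := charge_integral (cm_re mu) (@ccos R n)
  - charge_integral (cm_im mu) (@csin R n).
(** Twice the imaginary part of the Fourier coefficient. *)
Definition fourier_im mu n : R := charge_integral (cm_re mu) (@csin R n)
  + charge_integral (cm_im mu) (@ccos R n).

Lemma fourier_coefE mu n :
  fourier_coef mu n = 2^-1 * Complex (fourier_re mu n) (fourier_im mu n).
Proof. by []. Qed.

Lemma fourier_cvg mu m : concentrated mu E ->
  fourier_re mu (m + n_ k) @[k --> \oo] --> fourier_re mu m /\
  fourier_im mu (m + n_ k) @[k --> \oo] --> fourier_im mu m.
Proof.
move=> cE; have mE := measurable_dirichlet; have mEC := measurableC mE.
have re0 A : measurable A -> A `<=` ~` E -> cm_re mu A = 0%E.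
  by move=> mA AE; have [] := cm_variation_eq0 cE mEC mA AE.
have im0 A : measurable A -> A `<=` ~` E -> cm_im mu A = 0%E.
  by move=> mA AE; have [] := cm_variation_eq0 cE mEC mA AE.
have mc n : measurable_fun setT (@ccos R n).
  by have [] := @bounded_measurable_ccos R n.
have ms n : measurable_fun setT (@csin R n).
  by have [] := @bounded_measurable_csin R n.
have cc (nu : {charge set circle -> \bar R}) :
    (forall A, measurable A -> A `<=` ~` E -> nu A = 0%E) ->
    charge_integral nu (@ccos R (m + n_ k)) @[k --> \oo] -->
    charge_integral nu (@ccos R m).
  move=> nu0; apply: (charge_integral_cvg mE nu0 (B := 1)) => //.
    by move=> k x; exact: ccos_abs_le1.
  by move=> x Ex; exact: ccos_dirichlet.
have cs (nu : {charge set circle -> \bar R}) :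
    (forall A, measurable A -> A `<=` ~` E -> nu A = 0%E) ->
    charge_integral nu (@csin R (m + n_ k)) @[k --> \oo] -->
    charge_integral nu (@csin R m).
  move=> nu0; apply: (charge_integral_cvg mE nu0 (B := 1)) => //.
    by move=> k x; exact: csin_abs_le1.
  by move=> x Ex; exact: csin_dirichlet.
split; first exact: (cvgB (cc _ re0) (cs _ im0)).
exact: (cvgD (cs _ re0) (cc _ im0)).
Qed.

Lemma charge_trig_unique (nu : {charge set circle -> \bar R}) :
  (forall n, charge_integral nu (@ccos R n) = 0) ->
  (forall n, charge_integral nu (@csin R n) = 0) ->
  forall A, measurable A -> nu A = 0%E.
Proof.
move=> hc hs A mA; rewrite (jordan_decomp (hahn_posneg nu) mA).
rewrite /cadd /= cscaleN1.
have -> : jordan_pos (hahn_posneg nu) A = jordan_neg (hahn_posneg nu) A.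
  apply: finite_measure_trig_unique => // n; apply/eqP; rewrite -subr_eq0.
    exact/eqP/hc.
  exact/eqP/hs.
by rewrite subee// fin_num_measure.
Qed.

(** The coefficients of index n and - n together separate the four real integrals of
    cosine and sine against the real and imaginary parts of mu, which reduces the
    claim to real charges. *)
Lemma fourier_unique mu : (forall n, fourier_re mu n = 0) ->
  (forall n, fourier_im mu n = 0) ->
  forall A, measurable A -> cm_re mu A = 0%E /\ cm_im mu A = 0%E.
Proof.
move=> hre him A mA.
have cN (nu : {charge set circle -> \bar R}) n :
    charge_integral nu (@ccos R (- n)) = charge_integral nu (@ccos R n).
  by congr charge_integral; apply/funext => x; rewrite ccosN.
have sN (nu : {charge set circle -> \bar R}) n :
    charge_integral nu (@csin R (- n)) = - charge_integral nu (@csin R n).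
  rewrite -charge_integralN; last exact: bounded_measurable_csin.
  by congr charge_integral; apply/funext => x; rewrite csinN.
have solve (a b c d : R) : a - d = 0 -> a + d = 0 -> b + c = 0 -> - b + c = 0 ->
    [/\ a = 0, b = 0, c = 0 & d = 0] by move=> *; split; lra.
have h n : [/\ charge_integral (cm_re mu) (@ccos R n) = 0,
    charge_integral (cm_re mu) (@csin R n) = 0,
    charge_integral (cm_im mu) (@ccos R n) = 0 &
    charge_integral (cm_im mu) (@csin R n) = 0].
  have := hre (- n); have := him (- n); rewrite /fourier_re /fourier_im.
  rewrite !cN !sN opprK => h2 h1.
  exact: solve (hre n) h1 (him n) h2.
split.
  by apply: (charge_trig_unique _ _ mA) => n; have [rc rs _ _] := h n;
    [exact: rc|exact: rs].
by apply: (charge_trig_unique _ _ mA) => n; have [_ _ ic ins] := h n;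
  [exact: ic|exact: ins].
Qed.

Lemma modulus_half (a b : R) : normc (2^-1 * Complex a b) = 2^-1 * normc (Complex a b).
Proof.
rewrite normcM; congr (_ * _).
have -> : 2^-1 = Complex (2^-1 : R) 0 :> R[i].
  apply: (mulfI (x := 2)); first by rewrite pnatr_eq0.
  rewrite mulfV ?pnatr_eq0//; apply/eqP; rewrite eq_complex /=.
  by apply/andP; split; apply/eqP; field.
by rewrite /= expr0n /= addr0 sqrtr_sqr ger0_norm.
Qed.

(** The measure mu is used as its own witness: if its support were a Rajchman set,
    all its coefficients would tend to 0, and so would, for each m, the sequence of
    coefficients of index m + n_k, whose limit is the coefficient of index m. *)
Theorem dirichlet_parisian :
  (forall N : nat, exists K, forall k, (K <= k)%N -> (N <= `|n_ k|)%N) ->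
  parisian E.
Proof.
move=> n_oo; split; first exact: measurable_dirichlet.
move=> mu cE nac raj; apply: nac.
suff h m : fourier_re mu m = 0 /\ fourier_im mu m = 0.
  move=> A _ B mB _; apply: null_charges_cm_variation => //.
  by apply: fourier_unique => m; have [] := h m.
have v0 : vanishes_along (~` fourier_supp mu) (fourier_coef mu).
  move=> e e0; exists 0%N => n nS _.
  have -> : fourier_coef mu n = 0 by apply/eqP/negPn/negP.
  by rewrite normc0.
have v1 := raj _ v0.
have small e : 0 < e -> exists K, forall k, (K <= k)%N ->
    normc (Complex (fourier_re mu (m + n_ k)) (fourier_im mu (m + n_ k))) < e.
  move=> e0; have e2 : 0 < e / 2 by rewrite divr_gt0.
  have [N0 h0] := v0 _ e2; have [N1 h1] := v1 _ e2.
  (* The shift by m lowers |n_k| by at most |m|. *)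
  have [K hK] := n_oo (maxn N0 N1 + `|m|)%N; exists K => k Kk.
  have big : (maxn N0 N1 <= `|(m + n_ k)%R|)%N.
    have := hK k Kk; lia.
  have : normc (fourier_coef mu (m + n_ k)) < e / 2.
    have [hs|hs] := pselect (fourier_supp mu (m + n_ k)).
      by apply: h1 => //; exact: leq_trans (leq_maxr _ _) big.
    by apply: h0 => //; exact: leq_trans (leq_maxl _ _) big.
  by rewrite fourier_coefE modulus_half mulrC ltr_pM2r.
have [cre cim] := fourier_cvg m cE.
split.
  apply: (cvg_unique (@Rhausdorff R) cre); apply/cvgrPdist_lt => e e0.
  have [K hK] := small _ e0; exists K => // k Kk.
  rewrite sub0r normrN; apply: le_lt_trans (hK k Kk); exact: modulus_ge_Re.
apply: (cvg_unique (@Rhausdorff R) cim); apply/cvgrPdist_lt => e e0.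
have [K hK] := small _ e0; exists K => // k Kk.
rewrite sub0r normrN; apply: le_lt_trans (hK k Kk); exact: modulus_ge_Im.
Qed.

End DirichletSubgroup.

(** * Spreading the binary digits *)

Section Spreading.
Context (R : realType).
Local Notation circle := (circle R).
Implicit Types (t u : R) (j k : nat).

Definition qexp j := (j ^ 3)%N.
Definition pexp j := (j ^ 3 + j ^ 2)%N.
Local Notation q j := (2 ^+ qexp j : R).
Local Notation p j := (2 ^+ pexp j : R).

Definition ratio j := (2 ^ (qexp j.+1 - qexp j))%N.

Lemma qexpS j : qexp j.+1 = (qexp j + (3 * j ^ 2 + 3 * j + 1))%N.
Proof. by rewrite /qexp !expnS !expn0; lia. Qed.

Lemma qS j : q j.+1 = q j * (ratio j)%:R.
Proof. by rewrite /ratio natrX -exprD; congr (_ ^+ _); rewrite qexpS; lia. Qed.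

Lemma pS j : p j.+1 = p j * (ratio j)%:R * 2 ^+ (2 * j + 1).
Proof.
rewrite /ratio natrX -!exprD; congr (_ ^+ _); rewrite qexpS /pexp.
by rewrite !expnS !expn0; lia.
Qed.

Lemma p_gt0 j : 0 < p j. Proof. by rewrite exprn_gt0. Qed.

Lemma q_gt0 j : 0 < q j. Proof. by rewrite exprn_gt0. Qed.

(** For t in [0, 1), the first [qexp j] binary digits of t, read as an integer. *)
Definition prefix t j : int := Num.floor (q j * t).

(** The digits of t from position [qexp j] to [qexp j.+1], read as an integer. *)
Definition block t j : int := prefix t j.+1 - prefix t j * (ratio j)%:Z.

Lemma block_ge0 t j : 0 <= block t j.
Proof.
rewrite /block subr_ge0 /prefix Num.Theory.floor_ge_int intrM qS.
rewrite mulrAC ler_wpM2r// ?ler0n//.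
exact: Num.Theory.floor_le.
Qed.

Lemma block_le t j : block t j + 1 <= (ratio j)%:Z.
Proof.
rewrite /block -subr_ge0 -(@ler_int R).
have : (prefix t j.+1)%:~R < (prefix t j + 1)%:~R * (ratio j)%:R :> R.
  apply: le_lt_trans (Num.Theory.floor_le _) _.
  rewrite qS mulrAC ltr_pM2r; last by rewrite ltr0n expn_gt0.
  exact: Num.Theory.floorD1_gt.
rewrite -[X in _ * X]/((ratio j)%:~R) -intrM ltr_int => h.
by rewrite ler_int; move: h; rewrite mulrDl mul1r; lia.
Qed.

(** The weight [1 / p i.+1] of block [i] leaves [2 * i + 1] zero digits between
    the end of block [i - 1], at binary position [pexp i], and its own start. *)
Definition spread_upto t k : R := \sum_(i < k) (block t i)%:~R / p i.+1.

(** The largest value that the blocks of index at least k can reach: they start after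
    a run of [2 * k + 1] zeros that follows position [pexp k]. *)
Definition tail_bound k : R := 2 ^- (2 * k + 1) / p k.

Definition spread t : R := sup [set spread_upto t k | k in setT].

Lemma spread_uptoS t k :
  spread_upto t k.+1 = spread_upto t k + (block t k)%:~R / p k.+1.
Proof. by rewrite /spread_upto big_ord_recr. Qed.

Lemma tail_boundE k : tail_bound k = (ratio k)%:R / p k.+1.
Proof.
have r0 : (ratio k)%:R != 0 :> R by rewrite pnatr_eq0 -lt0n expn_gt0.
have p0 := lt0r_neq0 (p_gt0 k).
have s0 : 2 ^+ (2 * k + 1) != 0 :> R by rewrite expf_neq0 ?pnatr_eq0.
by rewrite /tail_bound pS; field; rewrite r0 p0 s0.
Qed.

Lemma tail_bound_le k : tail_bound k <= (2 * p k)^-1.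
Proof.
rewrite /tail_bound -invfM lef_pV2 ?posrE ?mulr_gt0 ?p_gt0 ?exprn_gt0//.
rewrite ler_pM2r ?p_gt0//; rewrite addn1 exprS ler_peMr//.
by rewrite exprn_ege1// ler1n.
Qed.

(** The upper ends [spread_upto t k + tail_bound k] decrease: the block of index k
    is at most [ratio k - 1], and the later blocks fit into one unit of its last
    digit. *)
Lemma spread_upto_le t k m : (k <= m)%N ->
  spread_upto t k <= spread_upto t m /\
  spread_upto t m + tail_bound m <= spread_upto t k + tail_bound k.
Proof.
move=> /subnK <-; elim: (m - k)%N => [|n [h1 h2]]; first by rewrite add0n.
rewrite addSn spread_uptoS; set i := (n + k)%N in h1 h2 *; split.
  apply: le_trans h1 _; rewrite lerDl divr_ge0 ?(ltW (p_gt0 _))//.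
  by rewrite ler0z block_ge0.
apply: le_trans h2; rewrite -addrA lerD2l.
have ti : tail_bound i.+1 <= 1 / p i.+1.
  rewrite /tail_bound ler_pM2r ?invr_gt0 ?p_gt0//.
  by rewrite invf_le1 ?exprn_gt0// exprn_ege1// ler1n.
rewrite (le_trans (lerD (lexx _) ti))// tail_boundE -mulrDl.
rewrite ler_pM2r ?invr_gt0 ?p_gt0//.
by rewrite -[1]/(1%:~R) -intrD -[leRHS]/((ratio i)%:~R) ler_int block_le.
Qed.

Lemma tail_bound_gt0 k : 0 < tail_bound k.
Proof. by rewrite divr_gt0 ?p_gt0// invr_gt0 exprn_gt0. Qed.

Lemma spread_upto_bounded t k m :
  spread_upto t m <= spread_upto t k + tail_bound k.
Proof.
have [km|/ltnW mk] := leqP k m.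
  have [_ h] := spread_upto_le t km.
  by apply: le_trans h; rewrite lerDl (ltW (tail_bound_gt0 m)).
have [h _] := spread_upto_le t mk.
by apply: le_trans h _; rewrite lerDl (ltW (tail_bound_gt0 k)).
Qed.

Lemma spread_itv t k :
  spread_upto t k <= spread t <= spread_upto t k + tail_bound k.
Proof.
apply/andP; split.
  apply: ub_le_sup; last by exists k.
  by exists (spread_upto t 0 + tail_bound 0) => _ [m _ <-];
    exact: spread_upto_bounded.
apply: ge_sup; first by exists (spread_upto t 0), 0%N.
by move=> _ [m _ <-]; exact: spread_upto_bounded.
Qed.

Lemma spread_in_half t : 0 <= spread t <= 2^-1.
Proof.
have := spread_itv t 0; rewrite /spread_upto big_ord0 add0r => /andP[-> h].
by rewrite (le_trans h)// (le_trans (tail_bound_le 0))// mulr1.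
Qed.

Lemma spread_upto_int t k : exists m : int, p k * spread_upto t k = m%:~R.
Proof.
elim: k => [|k [m hm]]; first by exists 0; rewrite /spread_upto big_ord0 mulr0.
exists (m * (ratio k)%:Z * 2 ^+ (2 * k + 1) + block t k).
rewrite spread_uptoS mulrDr mulrCA divff ?mulr1 ?lt0r_neq0 ?p_gt0//.
rewrite [RHS]intrD !intrM -hm pS; congr (_ + _).
have -> : (2 ^+ (2 * k + 1) : int)%:~R = 2 ^+ (2 * k + 1) :> R by rewrite rmorphXn.
by rewrite -[(ratio k)%:~R]/((ratio k)%:R : R); ring.
Qed.

(** The circle has period 2, so only an even multiple of [p k] sends the multiples of
    [1 / p k] to 0. *)
Definition freq k : int := (2 * 2 ^ pexp k)%N%:Z.

Lemma freqE k : (freq k)%:~R = 2 * p k :> R.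
Proof. by rewrite /freq -[LHS]/((2 * 2 ^ pexp k)%N%:R) natrM natrX. Qed.

Lemma freq_large N : exists K, forall k, (K <= k)%N -> (N <= `|freq k|)%N.
Proof.
exists N => k Nk; rewrite /freq absz_nat (leq_trans Nk)//.
rewrite (leq_trans (ltnW (ltn_expl k (ltnSn 1))))//.
rewrite (@leq_trans (2 ^ pexp k))//; last by rewrite leq_pmull.
rewrite leq_exp2l// /pexp; apply: leq_trans (leq_addl _ _).
by rewrite expnS expn1; case: (k) => // n; rewrite leq_pmull.
Qed.

(** Multiplying [spread t] by [p k] gives an integer plus at most [2 ^- (2 * k + 1)],
    by the run of zeros that precedes block [k]. *)
Lemma dirichlet_spread t : dirichlet_subgroup freq (\pi_circle (spread t)).
Proof.
pose d k : R := 2 * pi * (p k * (spread t - spread_upto t k)).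
have e k : ccos (freq k) (\pi_circle (spread t)) = cos (d k).
  rewrite ccos_pi freqE; have [m hm] := spread_upto_int t k.
  rewrite -[RHS](cosD2piz _ m); congr cos; rewrite /d.
  by rewrite -[pi *+ 2 *~ m]mulrzr -hm -[pi *+ 2]mulr_natr; ring.
rewrite /dirichlet_subgroup /= (_ : (fun k => _) = (fun k => cos (d k))); last first.
  by apply/funext.
rewrite -[X in _ --> X](@cos0 R).
apply: (@continuous_cvg _ _ _ _ _ d (@cos R)); first exact: continuous_cos.
rewrite -[X in _ --> X](mulr0 (2 * pi)); apply: cvgM; first exact: cvg_cst.
apply: (@squeeze_cvgr _ _ _ _ (fun=> 0) (fun k => (2^-1 : R) ^+ k)).
- apply: nearW => k; have /andP[h1 h2] := spread_itv t k.
  rewrite mulr_ge0 ?(ltW (p_gt0 _)) ?subr_ge0//=.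
  have h3 : spread t - spread_upto t k <= tail_bound k by rewrite lerBlDl.
  rewrite (le_trans (ler_wpM2l (ltW (p_gt0 _)) h3))// /tail_bound.
  rewrite mulrCA divff ?mulr1 ?lt0r_neq0 ?p_gt0// exprVn.
  rewrite lef_pV2 ?posrE ?exprn_gt0// ler_eXn2l ?ltr1n//.
  by rewrite mul2n -addnn -addnA leq_addr.
- exact: cvg_cst.
- by apply: cvg_expr; rewrite ger0_norm// invf_lt1// ltr1n.
Qed.

(** Take for j + 1 the first level at which the prefixes of t and u differ.  They
    agree at level j, so t and u are close; at level j + 1 the spread blocks differ
    by at least one unit, of which the tails recover at most half. *)
Lemma spread_separated t u : 0 <= t < 1 -> 0 <= u < 1 -> t != u ->
  exists j, `|t - u| <= (q j)^-1 /\ (2 * p j.+1)^-1 <= `|spread t - spread u|.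
Proof.
move=> t01 u01 tu.
have ex : exists k, prefix t k != prefix u k.
  have d0 : 0 < `|t - u| by rewrite normr_gt0 subr_eq0.
  pose k := Num.truncn `|t - u|^-1; exists k; apply/negP => /eqP e.
  have qk : k.+1%:R <= q k.
    rewrite -natrX ler_nat (leq_trans (ltn_expl k (ltnSn 1)))//.
    by rewrite leq_exp2l// /qexp !expnS expn0; case: (k) => // n; nia.
  have : `|t - u|^-1 < q k.
    by apply: lt_le_trans qk; exact: Num.Theory.truncnS_gt.
  rewrite invf_plt ?posrE ?q_gt0// => h.
  have : 1 < `|q k * t - q k * u|.
    by rewrite -mulrBr normrM gtr0_norm ?q_gt0// mulrC -ltr_pdivrMr ?q_gt0// mul1r.
  have := Num.Theory.floor_le (q k * t); have := Num.Theory.floor_le (q k * u).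
  have := Num.Theory.floorD1_gt (q k * t); have := Num.Theory.floorD1_gt (q k * u).
  rewrite -/(prefix t k) -/(prefix u k) e intrD => h1 h2 h3 h4.
  by apply/negP; rewrite -leNgt ler_norml; apply/andP; split; lra.
case: (ex_minnP ex) => -[|j] hj hmin.
  move: hj; rewrite /prefix /qexp exp0n// expr0 !mul1r.
  have f0 (v : R) : 0 <= v < 1 -> Num.floor v = 0.
    by move=> h; apply: Num.Theory.floor_def; rewrite add0r.
  by rewrite !f0// eqxx.
have eqp i : (i <= j)%N -> prefix t i = prefix u i.
  move=> ij; apply/eqP/negPn/negP => /hmin; by rewrite ltnNge ij.
exists j; split.
  have e := eqp _ (leqnn j).
  have := Num.Theory.floor_le (q j * t); have := Num.Theory.floor_le (q j * u).
  have := Num.Theory.floorD1_gt (q j * t); have := Num.Theory.floorD1_gt (q j * u).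
  rewrite -/(prefix t j) -/(prefix u j) e intrD => h1 h2 h3 h4.
  rewrite -[leRHS]mul1r ler_pdivlMr ?q_gt0// mulrC -[X in X * _]gtr0_norm ?q_gt0//.
  by rewrite -normrM mulrBr ler_norml; apply/andP; split; lra.
have eqs : spread_upto t j = spread_upto u j.
  apply: eq_bigr => i _; congr (_%:~R / _).
  by rewrite /block !eqp// ltnW.
have bj : 1 <= `|(block t j)%:~R - (block u j)%:~R| :> R.
  rewrite -intrB -intr_norm -[1]/(1%:~R) ler_int -gtz0_ge1 normr_gt0 subr_eq0.
  by rewrite /block (eqp j)// (inj_eq (addIr _)).
have : (p j.+1)^-1 <= `|spread_upto t j.+1 - spread_upto u j.+1|.
  rewrite !spread_uptoS eqs opprD addrACA subrr add0r -mulrBl normrM.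
  by rewrite [X in _ * X]gtr0_norm ?invr_gt0 ?p_gt0// ler_peMl// invr_ge0 (ltW (p_gt0 _)).
have := spread_itv t j.+1; have := spread_itv u j.+1; have := tail_bound_le j.+1.
rewrite invfM; set P := (p j.+1)^-1; have P0 : 0 < P by rewrite invr_gt0 p_gt0.
set T := tail_bound _ => hT /andP[u1 u2] /andP[t1 t2].
rewrite ler_normr => /orP[h|h]; rewrite ler_normr; apply/orP; [left|right]; lra.
Qed.

End Spreading.

(** * Hausdorff dimension *)

Section Hoelder.
Context (R : realType).
Implicit Types (s t u : R).

(** The exponents (j + 1) ^ 3 + (j + 1) ^ 2 and j ^ 3 differ by a quadratic term only,
    which (1 - s) j ^ 3 absorbs for large j. *)
Lemma exponent_gap s : 0 <= s < 1 -> exists c : R, forall j : nat,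
  s * (1 + pexp j.+1)%:R <= (qexp j)%:R + c.
Proof.
move=> /andP[s0 s1]; have d0 : 0 < 1 - s by rewrite subr_gt0.
(* The gap is at most 9 j ^ 2 + 3, and (1 - s) x ^ 3 dominates 9 x ^ 2 for x >= K. *)
pose K : R := 9 / (1 - s); exists (9 * K ^+ 2 + 3) => j.
have K0 : 0 <= K by rewrite divr_ge0// ltW.
have hj : (1 + pexp j.+1 <= qexp j + 9 * j ^ 2 + 3)%N.
  by rewrite /pexp /qexp !expnS !expn0; nia.
have {}hj : (1 + pexp j.+1)%:R <= j%:R ^+ 3 + 9 * j%:R ^+ 2 + 3 :> R.
  rewrite -!natrX -natrM -!natrD ler_nat; exact: hj.
apply: le_trans (ler_wpM2l s0 hj) _.
rewrite /qexp natrX; set x : R := j%:R; have x0 : 0 <= x by rewrite ler0n.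
have [xK|Kx] := leP x K.
  have h1 : x ^+ 2 <= K ^+ 2 by rewrite lerXn2r ?nnegrE.
  have h2 : 0 <= x ^+ 3 by rewrite exprn_ge0.
  have h3 : 0 <= x ^+ 2 by rewrite exprn_ge0.
  apply: le_trans (_ : 1 * (x ^+ 3 + 9 * x ^+ 2 + 3) <= _); last by lra.
  by apply: ler_wpM2r; [lra|exact: ltW].
have h1 : 9 * x ^+ 2 <= (1 - s) * x ^+ 3.
  have -> : (1 - s) * x ^+ 3 = ((1 - s) * x) * x ^+ 2 by ring.
  apply: ler_wpM2r; first by rewrite exprn_ge0.
  by rewrite -ler_pdivrMl// mulrC ltW.
have h2 : 0 <= x ^+ 2 by rewrite exprn_ge0.
have h4 : 0 <= K ^+ 2 by rewrite exprn_ge0.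
have h5 : s * (9 * x ^+ 2 + 3) <= 1 * (9 * x ^+ 2 + 3).
  by apply: ler_wpM2r; [lra|exact: ltW].
lra.
Qed.

(** At a separating level j, |t - u| is at most [2 ^- qexp j] and the spread points
    are at least [2 ^- (1 + pexp j.+1)] apart; compare the exponents. *)
Lemma spread_hoelder s : 0 <= s < 1 -> exists2 C : R, 0 < C &
  forall t u, 0 <= t < 1 -> 0 <= u < 1 ->
    `|t - u| <= C * `|spread t - spread u| `^ s.
Proof.
move=> s01; have /andP[s0 s1] := s01; have [c hc] := exponent_gap s01.
exists (2 `^ c); first exact: powR_gt0.
move=> t u t01 u01; have [->|tu] := eqVneq t u.
  by rewrite subrr normr0 mulr_ge0// powR_ge0.
have [j [h1 h2]] := spread_separated t01 u01 tu.
apply: le_trans h1 _.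
apply: (@le_trans _ _ (2 `^ c * (2 * 2 ^+ pexp j.+1)^-1 `^ s)); last first.
  apply: ler_wpM2l; first exact: powR_ge0.
  by apply: ge0_ler_powR => //; rewrite nnegrE// invr_ge0 mulr_ge0// exprn_ge0.
rewrite -exprS -!powR_invn// -powRrM -powRD ?pnatr_eq0 ?implybT//.
apply: ler_powR; first by rewrite ler1n.
by have := hc j; rewrite mulNr mulrC add1n; lra.
Qed.

Lemma cdist_ge0 (x y : circle R) : 0 <= cdist x y.
Proof.
apply: lb_le_inf; last by move=> _ [t _ <-].
by exists `|repr (x - y)|, (repr (x - y)) => //=; rewrite reprK.
Qed.

(** Any other lift of the difference is moved by a nonzero multiple of 2, hence has
    absolute value at least 2 - |t - u|. *)
Lemma cdist_pi_ge t u : `|t - u| <= 1 ->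
  `|t - u| <= cdist (\pi_(circle R) t) (\pi_(circle R) u).
Proof.
move=> tu; apply: lb_le_inf.
  by exists `|t - u|, (t - u) => //=; rewrite pi_circleB.
move=> _ [v /= hv <-]; move: hv; rewrite -pi_circleB => /eq_circleP[m ->].
have [->|m0] := eqVneq m 0; first by rewrite mul0r addr0.
have m1 : 1 <= `|m%:~R| :> R.
  by rewrite -intr_norm -[1]/(1%:~R) ler_int -gtz0_ge1 normr_gt0.
have h : `|m%:~R * 2| <= `|(t - u) + m%:~R * 2| + `|t - u| :> R.
  by rewrite -{1}(addrK (t - u) (m%:~R * 2)) [X in X - _]addrC ler_normB.
move: h; rewrite normrM (ger0_norm (ler0n _ 2)); lra.
Qed.

(** The parameters t with f t in U i lie within C (diam U i) ^ s of one another, hence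
    in an interval of twice that length; these intervals cover [0, 1), which has
    Lebesgue measure 1. *)
Lemma hausdorff_premeasure_ge (T : Type) (dist : T -> T -> R) (A : set T)
    (f : R -> T) s C :
  0 <= s -> 0 < C -> (forall x y, 0 <= dist x y) ->
  (forall t, 0 <= t < 1 -> A (f t)) ->
  (forall t u, 0 <= t < 1 -> 0 <= u < 1 ->
    `|t - u| <= C * dist (f t) (f u) `^ s) ->
  ((2 * C)^-1%:E <= hausdorff_premeasure dist s 1 A)%E.
Proof.
move=> s0 C0 dist0 Af hf; apply: le_ereal_inf_tmp => _ [U [AU dU] <-].
have g0 i : (0 <= hausdorff_gauge dist s (U i))%E.
  by rewrite /hausdorff_gauge; case: ifP => // _; exact: poweR_ge0.
have hI i : exists I : set R, [/\ measurable I,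
    (lebesgue_measure I <= (2 * C)%:E * hausdorff_gauge dist s (U i))%E &
    forall t, 0 <= t < 1 -> U i (f t) -> I t].
  have [[v [v01 Uv]]|nov] := pselect (exists v, 0 <= v < 1 /\ U i (f v)); last first.
    exists set0; split => //; last by move=> t t01 Ut; apply: nov; exists t.
    by rewrite measure0 mule_ge0// lee_fin mulr_ge0// ltW.
  have Une : (U i == set0) = false.
    by apply/negbTE/set0P; exists (f v).
  have d0 : (0 <= diameter dist (U i))%E by apply: ereal_sup_ubound; left.
  have dfin : diameter dist (U i) \is a fin_num.
    by rewrite ge0_fin_numE// (le_lt_trans (dU i))// ltry.
  pose d := fine (diameter dist (U i)).
  pose L := C * d `^ s.
  have L0 : 0 <= L by rewrite mulr_ge0 ?powR_ge0// ltW.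
  exists `[v - L, v + L]%classic; split => //.
  - rewrite /hausdorff_gauge Une -(fineK dfin) -/d poweR_EFin -EFinM.
    rewrite lebesgue_measure_itv /=; case: ifP => _; rewrite ?lee_fin.
      by rewrite /L; lra.
    by rewrite mulr_ge0 ?powR_ge0// mulr_ge0// ltW.
  - move=> t t01 Ut; have h : `|t - v| <= L.
      apply: le_trans (hf t v t01 v01) _; rewrite ler_wpM2l ?(ltW C0)//.
      apply: ge0_ler_powR => //; rewrite ?nnegrE ?fine_ge0//.
      rewrite -lee_fin fineK//; apply: ereal_sup_ubound; right.
      by exists (f t) => //; exists (f v).
    by rewrite /= in_itv /=; move: h; rewrite ler_norml => /andP[? ?];
      apply/andP; split; lra.
have [I hIP] := choice hI.
have : (lebesgue_measure (`[0%R, 1%R[%classic : set R) <=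
    \sum_(0 <= i <oo) lebesgue_measure (I i))%E.
  apply: measure_sigma_subadditive => //.
    by move=> i; have [] := hIP i.
  move=> t /=; rewrite in_itv /= => t01.
  have [i _ Ui] := AU _ (Af t t01).
  by exists i => //; have [_ _ h] := hIP i; exact: h.
rewrite lebesgue_measure_itv /= lte_fin ltr01 oppr0 adde0 => h1.
have h2 : (\sum_(0 <= i <oo) lebesgue_measure (I i) <=
    (2 * C)%:E * \sum_(0 <= i <oo) hausdorff_gauge dist s (U i))%E.
  rewrite -nneseriesZl//; apply: lee_nneseries => // i _.
  by have [] := hIP i.
have CC : 0 < 2 * C by rewrite mulr_gt0.
have := le_trans h1 h2.
by rewrite -lee_pdivrMl// mule1.
Qed.

Theorem dirichlet_hausdorff_dim :
  (1%:E <= hausdorff_dim (@cdist R) (dirichlet_subgroup freq))%E.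
Proof.
apply: le_ereal_inf_tmp => _ [s [s0 hs] <-]; rewrite lee_fin leNgt.
apply/negP => s1; have s01 : 0 <= s < 1 by rewrite s0.
have [C C0 hC] := spread_hoelder s01.
have : ((2 * C)^-1%:E <= 0 :> \bar R)%E.
  rewrite -[leRHS]hs; apply: le_trans (ereal_sup_ubound _); last first.
    by exists 1 => //=.
  apply: (@hausdorff_premeasure_ge _ _ _ (fun t => \pi_(circle R) (spread t))) => //.
  - exact: cdist_ge0.
  - by move=> t _; exact: dirichlet_spread.
  - move=> t u t01 u01; apply: le_trans (hC t u t01 u01) _.
    rewrite ler_wpM2l ?(ltW C0)//; apply: ge0_ler_powR => //.
      by rewrite nnegrE cdist_ge0.
    have /andP[? ?] := spread_in_half t; have /andP[? ?] := spread_in_half u.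
    by apply: cdist_pi_ge; rewrite ler_norml; apply/andP; split; lra.
by rewrite lee_fin leNgt invr_gt0 mulr_gt0.
Qed.

End Hoelder.

Theorem theoremB (R : realType) (alpha : R) (halpha : alpha < 1) :
  exists E : set (circle R),
    [/\ parisian E,
        zmod_closed (mem E) &
        (alpha%:E <= hausdorff_dim (@cdist R) E)%E].
Proof.
exists (dirichlet_subgroup freq); split.
- exact: dirichlet_parisian freq_large.
- exact: dirichlet_zmod_closed.
- apply: le_trans (dirichlet_hausdorff_dim R).
  by rewrite lee_fin ltW.
Qed.
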